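(* Let $\mathcal E$ be a Euclidean domain with value function $g:\mathcal E\to\mathbb R^+\cup\{0,-\infty\}$, $g(0)=-\infty$, and let $(\mathcal R,X,\mathcal N)$ be a digit system over $\mathcal E$ defined by $P$ such that $\mathcal N\subset\mathcal E$ and $g(e)<g(p_0)$ for all $e\in\mathcal N$. If $g(p_d)\ge g(p_0)$, then no element of $\Lambda_P$ other than $0$ has a finite $X$-ary expansion.
   Context: A Euclidean domain is an integral domain $\mathcal E$ with a value function $g$ such that for all $a,b$ with $b\neq0$ there are $q,r$ with $a=qb+r$ and $g(r)<g(b)$, and $g(a)\le g(ab)$ for nonzero $a,b$. Let $d\ge1$ and $P(x)=p_dx^d+\dots+p_1x+p_0\in\mathcal E[x]$ with $p_d,p_0\neq0$ and $\mathcal E/(p_0)$ finite. Let $\mathcal R=\mathcal E[x]/(P)$, $X$ the image of $x$, constants identified with $\mathcal E$. Let $\mathcal N\subset\mathcal R$ be a system of coset representatives of $\mathcal R/(X)$; $(\mathcal R,X,\mathcal N)$ is a digit system. $D_{\mathcal N}(A)$ is the unique $e\in\mathcal N$ with $A\equiv e\pmod X$, and $T(A)=\frac{A-D_{\mathcal N}(A)}{X}$. An element $A$ has a finite $X$-ary expansion if $T^n(A)=0$ for some $n\in\mathbb N$ (equivalently $A=\sum_{i=0}^{n-1}D_{\mathcal N}(T^i(A))X^i$). The Brunotte basis is $w_0=p_d$, $w_k=Xw_{k-1}+p_{d-k}$ ($k=1,\dots,d-1$), and $\Lambda_P$ is the $\mathcal E$-submodule of $\mathcal R$ generated by $w_0,\dots,w_{d-1}$.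 *)

(* Defs.v *)
From HB Require Import structures.
From mathcomp Require Import all_boot all_order all_algebra.
From mathcomp Require Import ring_quotient generic_quotient.
From mathcomp Require Import all_classical all_reals.

Set Implicit Arguments.
Unset Strict Implicit.
Unset Printing Implicit Defensive.

Import Order.TTheory GRing.Theory Num.Theory.

Local Open Scope classical_set_scope.
Local Open Scope quotient_scope.
Local Open Scope ring_scope.

Record euclidean_value (K : realType) (E : idomainType) (g : E -> \bar K) :
    Prop := EuclideanValue {
  euclidean_value_codom : forall a, g a = -oo%E \/ (0%:E <= g a < +oo)%E;
  euclidean_value_div : forall a b : E, b != 0 ->
    exists q r, a = q * b + r /\ (g r < g b)%E;
  euclidean_value_mul : forall a b : E, a != 0 -> b != 0 ->
    (g a <= g (a * b)%R)%E
}.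

Section PrincipalIdeal.
Variable A : comNzRingType.

Definition pideal (x : A) : {pred A} := fun a => `[< exists b, a = b * x >].

Lemma pidealP (x a : A) : reflect (exists b, a = b * x) (a \in pideal x).
Proof. exact: asboolP. Qed.

Lemma pideal_zmod_closed (x : A) : zmod_closed (pideal x).
Proof.
split; first by apply/pidealP; exists 0; rewrite mul0r.
move=> _ _ /pidealP[b ->] /pidealP[c ->].
by apply/pidealP; exists (b - c); rewrite mulrBl.
Qed.

HB.instance Definition _ (x : A) :=
  GRing.isZmodClosed.Build A (pideal x) (pideal_zmod_closed x).

(* The library gives [{ideal_quot (pideal x)}] an additive group structure for
   every [x], including the case of a unit [x], where the quotient is 0. *)
Definition coset_reps (x : A) (N : set A) : Prop :=
  forall c : {ideal_quot (pideal x)},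
    exists! e, N e /\ \pi_({ideal_quot (pideal x)}) e = c.

Definition digit (x : A) (N : set A) (a : A) : A :=
  xget 0 [set e | N e /\ a = e %[mod {ideal_quot (pideal x)}]].

Definition digit_map (x : A) (N : set A) (a : A) : A :=
  xget 0 [set b | x * b = a - digit x N a].

Definition finite_expansion (x : A) (N : set A) (a : A) : Prop :=
  exists n : nat, iter n (digit_map x N) a = 0.

Lemma digitP x N a : coset_reps x N ->
  N (digit x N a) /\ a = digit x N a %[mod {ideal_quot (pideal x)}].
Proof.
move=> /(_ (\pi a))[e [[Ne ea] _]]; rewrite /digit.
by case: xgetP => [_ _ //|/(_ e) []]; split.
Qed.

Lemma digit_mapP x N a : coset_reps x N ->
  a = digit x N a + x * digit_map x N a.
Proof.
move=> hN; have [_ /eqP] := digitP a hN.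
rewrite -Quotient.idealrBE => /pidealP[b ab].
suff -> : x * digit_map x N a = a - digit x N a by rewrite addrC subrK.
rewrite /digit_map.
by case: xgetP => [_ _ //|/(_ b) []]; rewrite /= ab mulrC.
Qed.

End PrincipalIdeal.

Section PolyQuotient.
Variables (E : idomainType) (P : {poly E}).

(* The argument [hd : deg P >= 1] makes the ideal (P) proper, as required by
   the library's ring structure on quotients. *)
Definition poly_ideal (hd : (1 < size P)%N) : {pred {poly E}} := pideal P.

Variable hd : (1 < size P)%N.

Lemma size_multiple (h : {poly E}) :
  (size (h * P)%R < size P)%N -> h = 0.
Proof.
have P0 : P != 0 by rewrite -size_poly_gt0 (ltn_trans _ hd).
have [->//|h0] := eqVneq h 0.
rewrite size_mul //; move: h0; rewrite -size_poly_gt0.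
by case: (size h) => // k _; rewrite addSn /= ltnNge leq_addl.
Qed.

Lemma poly_ideal_idealr : idealr_closed (poly_ideal hd).
Proof.
split; first by apply/pidealP; exists 0; rewrite mul0r.
  apply/negP => /pidealP[h h1].
  have h0 : h = 0 by apply: size_multiple; rewrite -h1 size_poly1.
  by move/eqP: h1; rewrite h0 mul0r oner_eq0.
move=> a _ _ /pidealP[b ->] /pidealP[c ->].
by apply/pidealP; exists (a * b + c); rewrite mulrDl mulrA.
Qed.

HB.instance Definition _ :=
  isIdealr.Build {poly E} (poly_ideal hd) poly_ideal_idealr.

Definition poly_quot : Type := {ideal_quot (poly_ideal hd)}.
HB.instance Definition _ := GRing.ComNzRing.on poly_quot.

Definition pq_pi (f : {poly E}) : poly_quot :=
  \pi_({ideal_quot (poly_ideal hd)}) f.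
Definition pq_X : poly_quot := pq_pi 'X.
Definition pq_const (a : E) : poly_quot := pq_pi a%:P.

Lemma pq_pi_eq f h : pq_pi f = pq_pi h <-> exists b, f - h = b * P.
Proof.
split=> [/eqP|bP]; last apply/eqP; rewrite /pq_pi -Quotient.idealrBE.
  by move=> /pidealP.
exact/pidealP.
Qed.

Lemma pq_pi_zmod_morphism : zmod_morphism pq_pi.
Proof. exact: (rmorphB \pi_({ideal_quot (poly_ideal hd)})). Qed.
Lemma pq_pi_monoid_morphism : monoid_morphism pq_pi.
Proof.
split; first exact: (rmorph1 \pi_({ideal_quot (poly_ideal hd)})).
exact: (rmorphM \pi_({ideal_quot (poly_ideal hd)})).
Qed.
HB.instance Definition _ :=
  GRing.isZmodMorphism.Build {poly E} poly_quot pq_pi pq_pi_zmod_morphism.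
HB.instance Definition _ :=
  GRing.isMonoidMorphism.Build {poly E} poly_quot pq_pi pq_pi_monoid_morphism.

Lemma pq_const_inj : injective pq_const.
Proof.
move=> a b /pq_pi_eq[h]; rewrite -polyCB => abP.
have h0 : h = 0.
  by apply: size_multiple; rewrite -abP (leq_ltn_trans (size_polyC_leq1 _)).
by move/eqP: abP; rewrite h0 mul0r polyC_eq0 subr_eq0 => /eqP.
Qed.

Lemma pq_X_lreg : P`_0 != 0 -> GRing.lreg pq_X.
Proof.
move=> p0 f h; rewrite -(reprK f) -(reprK h) -!/(pq_pi _) -!rmorphM.
set F := repr f; set H := repr h.
move=> /pq_pi_eq[b Xb]; apply/pq_pi_eq.
have b0 : b`_0 = 0.
  move/(congr1 (fun q : {poly E} => q`_0)): Xb.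
  rewrite -mulrBr coefXM coef0M /= => /esym/eqP.
  by rewrite mulf_eq0 (negPf p0) orbF => /eqP.
have /factor_theorem[c bc] : root b 0 by rewrite rootE horner_coef0 b0.
have X0 : 'X != 0 :> {poly E} by rewrite polyX_eq0.
exists c; apply: (mulfI X0).
by rewrite mulrBr Xb bc subr0 mulrA (mulrC 'X).
Qed.

Fixpoint brunotte (k : nat) : poly_quot :=
  if k is j.+1 then pq_X * brunotte j + pq_const P`_((size P).-1 - k)
  else pq_const (lead_coef P).

Definition brunotte_module : set poly_quot :=
  [set A | exists a : 'I_(size P).-1 -> E,
     A = \sum_(k < (size P).-1) pq_const (a k) * brunotte k].

Record digit_system (N : set poly_quot) : Prop := DigitSystem {
  digit_system_p0 : P`_0 != 0;
  digit_system_fin : finite_set [set: {ideal_quot (pideal P`_0)}];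
  digit_system_reps : coset_reps pq_X N
}.

End PolyQuotient.

Arguments brunotte {E P} hd k.
Arguments brunotte_module {E P} hd.

(* Main.v *)
From HB Require Import structures.
Require Import Defs.
From mathcomp Require Import all_boot all_order all_algebra.
From mathcomp Require Import ring_quotient generic_quotient.
From mathcomp Require Import all_classical all_reals.

Set Implicit Arguments.
Unset Strict Implicit.
Unset Printing Implicit Defensive.

Import Order.TTheory GRing.Theory Num.Theory.

Local Open Scope classical_set_scope.
Local Open Scope ring_scope.

(** With [d = deg P], [w_k] is the class of [sum_(j <= k) p_(d-k+j) x^j], a
    polynomial of degree [k < d], and [X w_(d-1) = - p_0].  The last relation
    makes the Brunotte module stable under the digit map [T], so it suffices to
    show that [T A = 0] forces [A = 0] for [A] in the module.  But [T A = 0]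
    makes [A] a digit [e], hence a constant; comparing degrees, the constants in
    the module are the multiples of [p_d], and a nonzero multiple [e] of [p_d]
    satisfies [g e >= g p_d >= g p_0 > g e]. *)

Lemma drop_polyS (R : nzRingType) (p : {poly R}) n :
  drop_poly n p = 'X * drop_poly n.+1 p + (p`_n)%:P.
Proof.
apply/polyP => i; rewrite coefD coefXM coefC !coef_drop_poly.
by case: i => [|i] /=; rewrite ?add0r ?addr0 ?addSnnS.
Qed.

Lemma drop_poly_pred_size (R : nzRingType) (p : {poly R}) :
  drop_poly (size p).-1 p = (lead_coef p)%:P.
Proof.
apply/polyP => i; rewrite coefC coef_drop_poly lead_coefE.
case: i => [|i] //=; rewrite nth_default // addSnnS.
by case: (size p) => //= n; rewrite addnS ltnS leq_addl.
Qed.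

Section BrunotteModule.
Variables (E : idomainType) (P : {poly E}) (hd : (1 < size P)%N).
Local Notation d := (size P).-1.
Local Notation w := (brunotte hd).
Local Notation pi := (pq_pi hd).
Local Notation X := (pq_X hd).
Local Notation c := (pq_const hd).

Lemma pq_const_zmod_morphism : zmod_morphism c.
Proof. by move=> a b; rewrite /pq_const polyCB rmorphB. Qed.
Lemma pq_const_monoid_morphism : monoid_morphism c.
Proof.
by split=> [|a b]; rewrite /pq_const ?polyC1 ?rmorph1 // polyCM rmorphM.
Qed.
HB.instance Definition _ :=
  GRing.isZmodMorphism.Build E (poly_quot hd) c pq_const_zmod_morphism.
HB.instance Definition _ :=
  GRing.isMonoidMorphism.Build E (poly_quot hd) c pq_const_monoid_morphism.

Lemma pq_pi_P : pi P = 0.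
Proof.
by rewrite -(rmorph0 pi); apply/pq_pi_eq; exists 1; rewrite subr0 mul1r.
Qed.

Lemma brunotteS k : w k.+1 = X * w k + c P`_(d - k.+1).
Proof. by []. Qed.

(** Horner's scheme: each step of the recursion multiplies by [x] and adds the next lower
    coefficient of [P]. The range includes [k = d], one past the basis. *)
Lemma brunotteE k : (k <= d)%N -> w k = pi (drop_poly (d - k) P).
Proof.
elim: k => [_|k IHk kd]; first by rewrite subn0 drop_poly_pred_size.
rewrite brunotteS IHk 1?ltnW // [in RHS]drop_polyS subnSK //.
by rewrite rmorphD rmorphM.
Qed.

Lemma brunotte_last : X * w d.-1 = - c P`_0.
Proof.
have d0 : (0 < d)%N by rewrite -ltnS prednK // (ltn_trans _ hd).
apply/eqP; rewrite -addr_eq0; apply/eqP.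
(* At [k = d] no coefficient is dropped, so [w d] is the class of [P], that is 0; one step of the
   recursion then gives the relation. *)
have := brunotteE (leqnn d); rewrite subnn drop_poly0l pq_pi_P => <-.
by rewrite -[in RHS](prednK d0) brunotteS prednK // subnn.
Qed.

(** Coefficients indexed by [nat] can be shifted to [a k.+1] without casts between ordinal types. *)
Lemma brunotte_moduleP (A : poly_quot hd) : brunotte_module hd A <->
  exists a : nat -> E, A = \sum_(k < d) c (a k) * w k.
Proof.
split=> [[a ->]|[a ->]]; last by exists (fun k => a k).
exists (fun k => oapp a 0 (insub k)); apply: eq_bigr => k _.
by rewrite insubT //= => kd; congr (c (a _) * _); apply: val_inj.
Qed.

(** Lifted to [{poly E}], the difference of the two sides is a multiple of [P], and the product with
    ['X] has no constant term; compare the coefficients of degree 0. *)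
Lemma pq_const_multX (s : E) (B : poly_quot hd) :
  c s = X * B -> exists q, s = q * P`_0.
Proof.
rewrite -(reprK B) -/(pq_pi hd (repr B)) /pq_X -rmorphM => /pq_pi_eq[b].
move=> /(congr1 (fun q : {poly E} => q`_0)).
rewrite coefB coefXM coefC coef0M /= subr0 => ->.
by exists b`_0.
Qed.

Lemma brunotte_module_digit_map (N : set (poly_quot hd)) A :
  digit_system N -> N `<=` range c -> brunotte_module hd A ->
  brunotte_module hd (digit_map X N A).
Proof.
move=> [p0 _ reps] NE /brunotte_moduleP[a Ea]; apply/brunotte_moduleP.
have [/NE[e _ eE] _] := digitP A reps.
have := digit_mapP A reps; rewrite -eE; set T := digit_map _ _ _.
have d0 : (0 < d)%N by rewrite -ltnS prednK // (ltn_trans _ hd).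
have last := brunotte_last; have wS := brunotteS.
move: Ea last wS; rewrite -[d](prednK d0); set m := d.-1 => Ea last wS AT.
(* The recursion for [w k.+1] splits [A]: [X * B] collects the shifted terms, and [s] the constants
   left over, including the one from [w 0]. *)
pose B := \sum_(k < m) c (a k.+1) * w k.
pose s := a 0%N * lead_coef P + \sum_(k < m) a k.+1 * P`_(m.+1 - k.+1).
have As : A = c s + X * B.
  rewrite Ea big_ord_recl /s rmorphD rmorphM -addrA; congr (_ + _).
  rewrite rmorph_sum mulr_sumr -big_split; apply: eq_bigr => k _.
  by rewrite lift0 wS mulrDr rmorphM addrC mulrCA.
have sX : c (s - e) = X * (T - B).
  rewrite rmorphB mulrBr; apply/eqP; rewrite subr_eq addrAC eq_sym.
  by rewrite subr_eq addrC -AT As.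
have [q sq] := pq_const_multX sX.
(* As [X * w m = - c P]_0[, the constant]s - e = q * P[_0] has class [X * (- c q * w m)]; cancelling
   the regular element [X] gives [T = B - c q * w m]. *)
exists (fun k => if k == m then - q else a k.+1).
rewrite big_ord_recr /= eqxx.
rewrite (_ : \sum_(i < m) _ = B); last first.
  by apply: eq_bigr => k _; rewrite ltn_eqF.
apply/eqP; rewrite addrC -subr_eq; apply/eqP; apply: (pq_X_lreg p0).
by rewrite -sX sq mulrCA last rmorphM rmorphN mulrNN.
Qed.

(** The [k]-th polynomial has degree exactly [k] and leading coefficient that of [P], so the
    summands of positive degree can be peeled off from the top. *)
Lemma sum_drop_poly_const (a : nat -> E) n : (n < d)%N ->
  (size (\sum_(k < n.+1) a k *: drop_poly (d - k) P)%R <= 1)%N ->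
  \sum_(k < n.+1) a k *: drop_poly (d - k) P = (a 0%N * lead_coef P)%:P.
Proof.
have dP : size P = d.+1 by rewrite prednK // (ltn_trans _ hd).
have sz k : (k <= d)%N -> size (drop_poly (d - k) P) = k.+1.
  by move=> kd; rewrite size_drop_poly [X in (X - _)%N]dP subSn ?leq_subr ?subKn.
elim: n => [d0 _|n IHn nd].
  rewrite big_ord_recl big_ord0 addr0 /= subn0 drop_poly_pred_size.
  by rewrite -mul_polyC polyCM.
rewrite big_ord_recr /=; set S := \sum_(i < n.+1) _ => szS.
have SzS : (size S <= n.+1)%N.
  apply: (leq_trans (size_sum _ _ _)); apply/bigmax_leqP => k _.
  rewrite (leq_trans (size_scale_leq _ _)) // sz //.
  by rewrite (leq_trans (ltnW (ltn_ord k))) // ltnW.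
(* [S] has degree at most [n], so in degree [n.+1] only [a n.+1 * lead_coef P] remains. *)
have a0 : a n.+1 = 0.
  have := nth_default 0 (leq_trans szS (isT : 1 <= n.+1)%N).
  rewrite coefD nth_default // add0r coefZ coef_drop_poly subnKC 1?ltnW //.
  move/eqP; rewrite mulf_eq0 => /orP[/eqP//|].
  by rewrite -lead_coefE lead_coef_eq0 -size_poly_eq0 dP.
by move: szS; rewrite a0 scale0r addr0; apply: IHn; rewrite ltnW.
Qed.

Lemma brunotte_module_const (e : E) :
  brunotte_module hd (c e) -> exists a, e = a * lead_coef P.
Proof.
move=> /brunotte_moduleP[a].
have dP : size P = d.+1 by rewrite prednK // (ltn_trans _ hd).
have d0 : (0 < d)%N by rewrite -ltnS -dP.
pose S := \sum_(k < d) a k *: drop_poly (d - k) P.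
have -> : \sum_(k < d) c (a k) * w k = pi S.
  rewrite rmorph_sum; apply: eq_bigr => k _.
  by rewrite brunotteE 1?ltnW // -mul_polyC rmorphM.
move=> /pq_pi_eq[h eSh].
have SzS : (size S <= d)%N.
  apply: (leq_trans (size_sum _ _ _)); apply/bigmax_leqP => k _.
  rewrite (leq_trans (size_scale_leq _ _)) // size_drop_poly.
  by rewrite [X in (X - _)%N]dP subSn ?leq_subr ?subKn // ltnW.
(* Both [e] and [S] have degree below [d], so their congruence modulo [P] is an equality of
   polynomials. *)
have h0 : h = 0.
  apply: (size_multiple hd); rewrite -eSh [X in (_ < X)%N]dP ltnS.
  rewrite (leq_trans (size_polyD _ _)) // size_polyN geq_max SzS andbT.
  exact: leq_trans (size_polyC_leq1 _) d0.
move/eqP: eSh; rewrite h0 mul0r subr_eq0 => /eqP eS.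
exists (a 0%N); apply: polyC_inj; rewrite eS /S.
have := @sum_drop_poly_const a d.-1; rewrite prednK // => -> //.
by rewrite -/S -eS size_polyC_leq1.
Qed.

End BrunotteModule.

Theorem theorem3p10 (K : realType) (E : idomainType) (g : E -> \bar K)
    (hg : euclidean_value g) (hg0 : g 0 = -oo%E)
    (P : {poly E}) (hd : (1 < size P)%N) (N : set (poly_quot hd))
    (hN : digit_system N)
    (hNE : N `<=` range (pq_const hd))
    (hNg : forall e : E, N (pq_const hd e) -> (g e < g P`_0)%E)
    (hpd : (g P`_0 <= g (lead_coef P))%E) :
  forall A : poly_quot hd, brunotte_module hd A -> A <> 0 ->
    ~ finite_expansion (pq_X hd) N A.
Proof.
move=> A LA A0 [n]; elim: n A LA A0 => [A _ A0 //|n IHn A LA A0].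
rewrite iterSr; apply: IHn; first exact: brunotte_module_digit_map.
move=> TA0; apply: A0.
have reps := digit_system_reps hN; have [Ne _] := digitP A reps.
have := digit_mapP A reps; rewrite TA0 mulr0 addr0 => AD.
have [e _ eA] := hNE _ Ne.
move: LA Ne; rewrite [A in brunotte_module _ A]AD [A in _ -> _ -> A = _]AD -eA.
move=> /brunotte_module_const[a ->] /hNg lt_e.
(* If [a = 0], the digit is 0 and so is [A]; the inequality on values applies only to nonzero
   factors. *)
have [->|a0] := eqVneq a 0; first by rewrite mul0r rmorph0.
have P0 : lead_coef P != 0.
  by rewrite lead_coef_eq0 -size_poly_gt0 (ltn_trans _ hd).
have := le_lt_trans (euclidean_value_mul hg P0 a0).
by rewrite mulrC => /(_ _ lt_e); rewrite ltNge hpd.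
Qed.
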